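(* Let $a\in(0,\infty]$, let $w$ be an even function, positive on $(-a,a)$, with finite moments, let $(P_n)_{n\ge0}$ be the monic orthogonal polynomials with respect to $w(x)\,dx$ on $(-a,a)$, let $M\in\mathbb{R}\setminus\{0\}$, and let $$\langle\mathbf{w},p\rangle=\int_0^a[p(x)+p(-x)-2p(0)]\frac{w(x)}{x^2}\,dx+M\,p(0).$$ Assume $\langle\mathbf{w},P_{2n}\rangle\neq0$ for all $n\ge0$, and let $(R_n)_{n\ge0}$ be the sequence of monic polynomials with $R_0=1$ and $R_n=P_{n+1}+\beta_nP_{n-1}$ for $n\ge1$, where the real numbers $\beta_n$ are such that $R_n'(0)=0$ and $\langle\mathbf{w},R_n\rangle=0$ for all $n\ge1$. Then $(R_n)_{n\ge0}$ is orthogonal with respect to $\mathbf{w}$: for all $n,m\ge0$, $$\langle\mathbf{w},R_nR_m\rangle=K_n\,\delta_{n,m},\qquad K_n\ne0.$$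
   Context: Under the assumption $\langle\mathbf{w},P_{2n}\rangle\neq0$ for all $n$ (and since $P'_{2n+1}(0)\ne0$ automatically), the coefficients exist and are given by $\beta_{2n+1}=-\langle\mathbf{w},P_{2n+2}\rangle/\langle\mathbf{w},P_{2n}\rangle$ ($n\ge0$), $\beta_{2n}=-P_{2n+1}'(0)/P_{2n-1}'(0)$ ($n\ge1$). Note $\deg R_0=0$ and $\deg R_n=n+1$ for $n\ge1$ (no polynomial of degree one). *)

(* Defs.v *)
From HB Require Import structures.
From mathcomp Require Import all_boot all_order all_algebra.
From mathcomp Require Import all_classical all_reals all_analysis.

Set Implicit Arguments.
Unset Strict Implicit.
Unset Printing Implicit Defensive.

Import Order.TTheory GRing.Theory Num.Theory.
Import numFieldNormedType.Exports.

Local Open Scope classical_set_scope.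
Local Open Scope ring_scope.

(* The endpoint a is extended so that a = +oo gives the whole real line. *)
Definition sym_itv (R : realType) (a : \bar R) : set R :=
  [set x | (- a < x%:E)%E /\ (x%:E < a)%E].

Definition pos_itv (R : realType) (a : \bar R) : set R :=
  [set x | 0 < x /\ (x%:E < a)%E].

Definition even_on (R : realType) (A : set R) (w : R -> R) : Prop :=
  forall x, A x -> w (- x) = w x.

(* Taking n = 0, this includes measurability and integrability of w on A. *)
Definition finite_moments (R : realType) (A : set R) (w : R -> R) : Prop :=
  forall n : nat,
    (@lebesgue_measure R).-integrable A (EFin \o (fun x => x ^+ n * w x)).

(* Nonvanishing of the integrals of (P n) ^+ 2 * w is not required here: it
   follows from monicity when w is positive. *)
Definition monic_orthogonal_polys (R : realType) (A : set R) (w : R -> R)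
    (P : nat -> {poly R}) : Prop :=
  [/\ forall n, P n \is monic,
      forall n, size (P n) = n.+1 &
      forall n m, n <> m ->
        \int[@lebesgue_measure R]_(x in A) ((P n).[x] * (P m).[x] * w x) = 0].

(* The quotient by x ^+ 2 is harmless: p(x) + p(-x) - 2 p(0) is divisible by
   x ^+ 2, so the integral converges whenever w has finite moments. *)
Definition wfunctional (R : realType) (a : \bar R) (w : R -> R) (M : R)
    (p : {poly R}) : R :=
  \int[@lebesgue_measure R]_(x in pos_itv a)
    ((p.[x] + p.[- x] - 2 * p.[0]) * (w x / x ^+ 2)) + M * p.[0].

(* Main.v *)
(* With L(q) the integral of q w over (-a, a), the functional satisfies
   <w, x^2 q> = L(q).  Since R_m'(0) = 0, one has R_m = R_m(0) + x^2 S_m with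
   deg S_m = m - 1, so for 1 <= m <= n, using <w, R_n> = 0,
     <w, R_n R_m> = L(R_n S_m) = L(P_(n+1) S_m) + beta_n L(P_(n-1) S_m),
   which vanishes for m < n and equals beta_n L(P_(n-1)^2) for m = n.
   For n odd, beta_n <> 0 because <w, P_(n+1)> <> 0; for n even, because
   P_(n+1)'(0) <> 0: the polynomial P_(n+1) is odd, and if it were x^2 u, then
   0 = L(P_(n+1) u) = L((x u)^2) would force u = 0. *)

Require Import Defs.
From HB Require Import structures.
From mathcomp Require Import all_boot all_order all_algebra.
From mathcomp Require Import all_classical all_reals all_analysis.
From mathcomp Require Import measurable_realfun ring.

Set Implicit Arguments.
Unset Strict Implicit.
Unset Printing Implicit Defensive.

Import Order.TTheory GRing.Theory Num.Theory.
Import numFieldNormedType.Exports.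

Local Open Scope classical_set_scope.
Local Open Scope ring_scope.

(** * Coefficients and sizes of monic polynomials *)

Lemma poly_coef1_eq0 (F : nzSemiRingType) (p : {poly F}) :
  p`_1 = 0 -> p = (p`_0)%:P + drop_poly 2 p * 'X^2.
Proof.
move=> p1; rewrite -{1}(poly_take_drop 2 p); congr (_ + _).
by apply/polyP=> -[|[|i]]; rewrite coef_take_poly coefC.
Qed.

Lemma monic_coefn (F : nzSemiRingType) (p : {poly F}) (n : nat) :
  p \is monic -> size p = n.+1 -> p`_n = 1.
Proof. by move=> /monicP <-; rewrite lead_coefE => ->. Qed.

Lemma size_sub_monic (F : nzRingType) (p q : {poly F}) (n : nat) :
  p \is monic -> q \is monic -> size p = n.+1 -> size q = n.+1 ->
  (size (p - q)%R <= n)%N.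
Proof.
move=> pm qm ps qs; apply/leq_sizeP => j; rewrite leq_eqVlt => /orP[/eqP <-|nj].
  by rewrite coefB !(monic_coefn _ ps, monic_coefn _ qs) // subrr.
by rewrite coefB !nth_default ?subrr // ?ps ?qs.
Qed.

(** * Orthogonal polynomials of a linear, even functional [L] that is definite on squares *)

Section OrthogonalPolynomials.
Variables (F : realFieldType) (L : {poly F} -> F) (P : nat -> {poly F}).
Hypothesis LP : forall c (p q : {poly F}), L (c *: p + q) = c * L p + L q.
Hypothesis L_pos : forall p : {poly F}, L (p * p) = 0 -> p = 0.
Hypothesis L_even : forall p, L (p \Po - 'X) = L p.
Hypothesis P_monic : forall n, P n \is monic.
Hypothesis P_size : forall n, size (P n) = n.+1.
Hypothesis P_ortho : forall n m, n <> m -> L (P n * P m) = 0.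

Let L0 : L 0 = 0.
Proof. by have := LP (-1) 0 0; rewrite scaler0 addr0 mulN1r addNr. Qed.

Let LD (p q : {poly F}) : L (p + q) = L p + L q.
Proof. by have := LP 1 p q; rewrite scale1r mul1r. Qed.

Let LZ c (p : {poly F}) : L (c *: p) = c * L p.
Proof. by have := LP c p 0; rewrite addr0 L0 addr0. Qed.

Lemma ortho_lower_degree n (q : {poly F}) : (size q <= n)%N -> L (P n * q) = 0.
Proof.
suff H m : (m <= n)%N ->
    forall q : {poly F}, (size q <= m)%N -> L (P n * q) = 0 by exact: H.
elim: m => [_|m IHm mn] {}q.
  by rewrite leqn0 size_poly_eq0 => /eqP->; rewrite mulr0.
move=> qm; rewrite -(subrK (q`_m *: P m) q) mulrDr LD -scalerAr LZ.
rewrite P_ortho ?mulr0 ?addr0; last by move=> e; rewrite e ltnn in mn.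
apply: IHm; first exact: ltnW.
apply/leq_sizeP => j; rewrite leq_eqVlt coefB coefZ => /orP[/eqP <-|mj].
  by rewrite (monic_coefn (P_monic m) (P_size m)) mulr1 subrr.
by rewrite (nth_default _ (leq_trans qm mj)) [(P m)`_j]nth_default ?P_size // mulr0 subrr.
Qed.

(** Let [q] be the reflection of [p]. Then [p + q] is even and of lower degree than [p], so [p], and
    by evenness of [L] also [q], is orthogonal to it. Hence [L] vanishes on the square of [p + q],
    so [p] is odd. *)
Lemma ortho_odd_coef0 k : (P k.*2.+1)`_0 = 0.
Proof.
set p := P _; pose q := p \Po - 'X.
have sX : size (- 'X : {poly F}) = 2 by rewrite size_polyN size_polyX.
have q_size : size (- q)%R = k.*2.+2 by rewrite size_polyN size_comp_poly2 // P_size.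
(* The odd degree gives [q] the leading coefficient -1, so it is [- q] that is compared with [p]. *)
have q_monic : - q \is monic.
  apply/monicP; rewrite lead_coefN lead_coef_comp ?sX //.
  rewrite lead_coefN lead_coefX (monicP (P_monic _)) P_size mul1r.
  by rewrite -signr_odd /= odd_double /= expr1 opprK.
have pq_size := size_sub_monic (P_monic _) q_monic (P_size k.*2.+1) q_size.
rewrite opprK -/p in pq_size.
have pqN : (p + q) \Po - 'X = p + q.
  rewrite comp_polyD -comp_polyA raddfN /= comp_polyX opprK comp_polyXr addrC //.
have Lp : L (p * (p + q)) = 0 by exact: ortho_lower_degree.
have pq0 : p + q = 0.
  apply: L_pos; rewrite mulrDl LD Lp add0r -Lp -[RHS]L_even.
  by rewrite comp_polyM pqN.
move/(congr1 (fun r : {poly F} => r.[0])): pq0.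
rewrite hornerD horner_comp hornerN hornerX oppr0 horner0 horner_coef0 => /eqP.
by rewrite -mulr2n mulrn_eq0 => /eqP.
Qed.

Lemma ortho_odd_coef1 k : (P k.*2.+1)`_1 != 0.
Proof.
apply/eqP => p1; have p0 := ortho_odd_coef0 k.
have pE := poly_coef1_eq0 p1; rewrite p0 polyC0 add0r in pE.
set u := drop_poly 2 _ in pE.
have : L (P k.*2.+1 * u) = 0.
  by apply: ortho_lower_degree; rewrite size_drop_poly P_size !subSS subn0 leqnSn.
rewrite {1}pE mulrAC -mulrA (_ : u * (u * 'X^2) = (u * 'X) * (u * 'X)).
  move=> /L_pos/eqP; rewrite mulf_eq0 polyX_eq0 orbF => /eqP u0.
  by have := P_size k.*2.+1; rewrite pE u0 mul0r size_poly0.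
by rewrite expr2 mulrA mulrACA.
Qed.

(** * The functional [W] and the orthogonality of the polynomials [R_] *)

Variables (W : {poly F} -> F) (R_ : nat -> {poly F}) (beta : nat -> F).
Hypothesis WP : forall c (p q : {poly F}), W (c *: p + q) = c * W p + W q.
Hypothesis W_X2 : forall p : {poly F}, W (p * 'X^2) = L p.
Hypothesis W1_neq0 : W 1 != 0.
Hypothesis WP_neq0 : forall n, W (P n.*2) != 0.
Hypothesis R_monic : forall n, R_ n \is monic.
Hypothesis R_0 : R_ 0%N = 1.
Hypothesis R_E : forall n, (1 <= n)%N -> R_ n = P n.+1 + beta n *: P n.-1.
Hypothesis R_coef1 : forall n, (1 <= n)%N -> (R_ n)`_1 = 0.
Hypothesis WR_0 : forall n, (1 <= n)%N -> W (R_ n) = 0.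

Lemma size_R n : (1 <= n)%N -> size (R_ n) = n.+2.
Proof.
move=> n1; rewrite R_E // size_polyDl P_size //.
by rewrite (leq_ltn_trans (size_scale_leq _ _)) // P_size prednK // ltnW.
Qed.

Lemma beta_neq0 n : (1 <= n)%N -> beta n != 0.
Proof.
move=> n1; apply/eqP => b0.
have RE : R_ n = P n.+1 by rewrite R_E // b0 scale0r addr0.
have nE := odd_double_half n; case: (odd n) nE => /= nE.
  by have := WR_0 n1; rewrite RE -nE => /eqP; rewrite (negbTE (WP_neq0 _.+1)).
by have := R_coef1 n1; rewrite RE -nE => /eqP; rewrite (negbTE (ortho_odd_coef1 _)).
Qed.

Lemma W_mulR n (p : {poly F}) : (1 <= n)%N -> p`_1 = 0 ->
  W (R_ n * p) = L (P n.+1 * drop_poly 2 p) + beta n * L (P n.-1 * drop_poly 2 p).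
Proof.
move=> n1 p1; rewrite {1}(poly_coef1_eq0 p1) mulrDr mulrC mul_polyC mulrA WP WR_0 //.
by rewrite mulr0 add0r W_X2 {1}R_E // mulrDl LD -scalerAl LZ.
Qed.

Lemma W_mulR_lt n m : (m < n)%N -> W (R_ n * R_ m) = 0.
Proof.
case: m => [|m] mn; first by rewrite R_0 mulr1 WR_0.
have n1 : (1 <= n)%N by exact: leq_ltn_trans mn.
(* This size is [m.+1], and [m.+1 < n] is exactly what orthogonality to [P n.-1] needs; [P n.+1]
   leaves room to spare. *)
have sz : (size (drop_poly 2 (R_ m.+1)) <= n.-1)%N.
  by rewrite size_drop_poly size_R // -ltnS prednK // !subSS subn0.
rewrite W_mulR ?R_coef1 // !ortho_lower_degree ?mulr0 ?addr0 //.
by rewrite (leq_trans sz) // (leq_trans (leq_pred _)) // leqnSn.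
Qed.

Lemma W_sqrR_neq0 n : W (R_ n * R_ n) != 0.
Proof.
case: n => [|n]; first by rewrite R_0 mulr1.
set S := drop_poly 2 (R_ n.+1).
have S_size : size S = n.+1 by rewrite size_drop_poly size_R // !subSS subn0.
have S_monic : S \is monic.
  rewrite monicE lead_coefE S_size coef_drop_poly addn2.
  by rewrite (monic_coefn (R_monic _)) // size_R.
rewrite W_mulR ?R_coef1 // -/S /= ortho_lower_degree ?S_size ?leqnSn // add0r.
(* [S] and [P n] are both monic of degree [n], so [S - P n] is orthogonal to [P n], and only
   [L (P n * P n)] remains. *)
rewrite mulf_neq0 ?beta_neq0 // -(subrK (P n) S) mulrDr LD.
rewrite ortho_lower_degree ?add0r; last exact: size_sub_monic.
by apply/eqP => /L_pos /eqP; rewrite (negbTE (monic_neq0 (P_monic n))).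
Qed.

Lemma R_orthogonal : exists K : nat -> F, (forall n, K n != 0) /\
  (forall n m, W (R_ n * R_ m) = K n * (n == m)%:R).
Proof.
exists (fun n => W (R_ n * R_ n)); split => [n|n m]; first exact: W_sqrR_neq0.
have [nm|mn|->] := ltngtP n m; last by rewrite mulr1.
  by rewrite (mulrC (R_ n)) (W_mulR_lt nm) mulr0n mulr0.
by rewrite (W_mulR_lt mn) mulr0n mulr0.
Qed.

End OrthogonalPolynomials.

(** An infinite root set would contain [size p] distinct roots, one more than the degree allows. *)
Lemma finite_set_root (F : idomainType) (p : {poly F}) :
  p != 0 -> finite_set [set x | root p x].
Proof.
move=> p0; apply: contrapT => /(@infinite_set_fset _ _ (size p)) [B Bp Bsize].
have := max_poly_roots p0 _ (finmap.fset_uniq B).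
rewrite ltnNge Bsize => /(_ _)/notF; apply.
by apply/allP => x /Bp.
Qed.

(** * Reflection of Lebesgue integrals, and the intervals attached to [a] *)

Section Lebesgue.
Variable R : realType.
Notation mu := (@lebesgue_measure R).

(* lebesgue_measure is a measure on measurableTypeR R, which does not unify with
   the default measurable structure of R, hence the explicit annotations. *)
Lemma integral_oppr (D : set R) (f : R -> \bar R) :
  @measurable _ (measurableTypeR R) D ->
  measurable_fun (T := measurableTypeR R) D f ->
  (\int[mu]_(x in D) f x = \int[mu]_(x in -%R @^-1` D) f (- x)%R)%E.
Proof.
(* For nonnegative functions this is a change of variables, Lebesgue measure being its own image
   under negation. The general case follows by positive and negative parts. *)
move=> mD mf; have ge0 (g : R -> \bar R) :
    measurable_fun (T := measurableTypeR R) D g -> (forall x, (0 <= g x)%E) ->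
    (\int[mu]_(x in D) g x = \int[mu]_(x in -%R @^-1` D) (g \o -%R) x)%E.
  move=> mg g0.
  rewrite -[RHS](@ge0_integral_pushforward _ _
    (measurableTypeR R) (measurableTypeR R) R (-%R)) //.
  by apply: eq_measure_integral => //= A mA _; exact/esym/lebesgue_measureN.
rewrite integralE [RHS]integralE.
by rewrite (funepos_comp f -%R) (funeneg_comp f -%R) !ge0 //;
  [exact: measurable_funeneg|exact: measurable_funepos].
Qed.

Lemma Rintegral_oppr (D : set R) (f : R -> R) :
  @measurable _ (measurableTypeR R) D -> mu.-integrable D (EFin \o f) ->
  \int[mu]_(x in D) f x = \int[mu]_(x in -%R @^-1` D) f (- x).
Proof.
move=> mD intf; rewrite /Rintegral (integral_oppr mD) //.
exact: (measurable_int mu intf).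
Qed.

Variables (a : \bar R) (w : R -> R).
Hypothesis a_gt0 : (0 < a)%E.

Lemma measurable_sym_itv : @measurable _ (measurableTypeR R) (sym_itv a).
Proof.
case: a a_gt0 => [r||] //= r0.
  rewrite (_ : sym_itv _ = `]- r, r[%classic) //; apply/seteqP; split=> x /=.
    by rewrite /sym_itv /= in_itv /= !lte_fin => -[-> ->].
  by rewrite /sym_itv /= in_itv /= !lte_fin => /andP.
rewrite (_ : sym_itv _ = setT) //; apply/seteqP; split=> x //= _.
by rewrite /sym_itv /= ltNyr ltry.
Qed.

Lemma measurable_pos_itv : @measurable _ (measurableTypeR R) (pos_itv a).
Proof.
case: a a_gt0 => [r||] //= r0.
  rewrite (_ : pos_itv _ = `]0, r[%classic) //; apply/seteqP; split=> x /=.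
    by rewrite /pos_itv /= in_itv /= !lte_fin => -[-> ->].
  by rewrite /pos_itv /= in_itv /= !lte_fin => /andP.
rewrite (_ : pos_itv _ = `]0, +oo[%classic) //; apply/seteqP; split=> x /=.
  by rewrite /pos_itv /= in_itv /= andbT => -[].
by rewrite /pos_itv /= in_itv /= andbT ltry.
Qed.

Lemma sub_pos_sym_itv : pos_itv a `<=` sym_itv a.
Proof.
move=> x [x0 xa]; split=> //; apply: (@lt_trans _ _ 0%E); last by rewrite lte_fin.
by rewrite lteNl oppe0.
Qed.

Lemma sym_itv_oppr x : sym_itv a x -> sym_itv a (- x).
Proof. by move=> [ax xa]; split; rewrite EFinN ?lteN2 // lteNl. Qed.

Lemma sym_itv_split :
  sym_itv a = (pos_itv a `|` -%R @^-1` pos_itv a) `|` [set 0].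
Proof.
apply/seteqP; split=> x /=.
  move=> xa; have [_ nxa] := sym_itv_oppr xa.
  have [x0|x0|->] := ltgtP x 0; [left;right|left;left|right] => //.
  - by split => //; rewrite oppr_gt0.
  - by case: xa.
move=> [[/sub_pos_sym_itv //|/sub_pos_sym_itv/sym_itv_oppr]|->]; first by rewrite opprK.
by rewrite /sym_itv /= lteNl oppe0.
Qed.

(** The interval contains []0, b[] for some real [b] below [a]. Positive measure prevents it from
    being covered by a null set and finitely many roots. *)
Lemma sym_itv_mu_gt0 : (0 < mu (sym_itv a))%E.
Proof.
have [b b0 ba] : exists2 b : R, 0 < b & (b%:E < a)%E.
  case: a a_gt0 => [r||] // r0; last by exists 1 => //; exact: ltry.
  rewrite lte_fin in r0; exists (r / 2); rewrite ?lte_fin ?divr_gt0 //.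
  by rewrite ltr_pdivrMr // ltr_pMr // ltr1n.
apply: (@lt_le_trans _ _ (mu `]0, b[%classic)).
  by rewrite lebesgue_measure_itv /= lte_fin b0 -EFinB subr0 lte_fin.
apply: le_measure; rewrite ?inE //; first exact: measurable_sym_itv.
move=> x /=; rewrite in_itv /= => /andP[x0 xb]; apply: sub_pos_sym_itv; split => //.
by rewrite (lt_trans _ ba) // lte_fin.
Qed.

(** * The weight integral and its relation to [wfunctional] *)

Hypothesis w_even : even_on (sym_itv a) w.
Hypothesis w_gt0 : forall x, sym_itv a x -> 0 < w x.
Hypothesis w_mom : finite_moments (sym_itv a) w.

Definition weight_integral (p : {poly R}) : R :=
  \int[mu]_(x in sym_itv a) (p.[x] * w x).
Local Notation L := weight_integral.

Lemma integrable_poly_weight (p : {poly R}) :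
  mu.-integrable (sym_itv a) (EFin \o (fun x => p.[x] * w x)).
Proof.
have -> : EFin \o (fun x => p.[x] * w x) =
    (fun x => \sum_(i < size p) (p`_i)%:E * (x ^+ i * w x)%:E)%E.
  apply/funext => x /=; rewrite horner_coef mulr_suml -sumEFin.
  by apply: eq_bigr => i _; rewrite -EFinM mulrA.
apply: integrable_sum; first exact: measurable_sym_itv.
move=> i _; apply: integrableZl; first exact: measurable_sym_itv.
exact: w_mom.
Qed.

Lemma weight_integralP c (p q : {poly R}) : L (c *: p + q) = c * L p + L q.
Proof.
have mA := measurable_sym_itv.
have ip := integrable_poly_weight p.
rewrite /L -RintegralZl // -RintegralD //; last 2 first.
- exact: (integrableZl mA c ip).
- exact: integrable_poly_weight.
by apply: eq_Rintegral => x _; rewrite hornerD hornerZ mulrDl mulrA.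
Qed.

(** The nonnegative integrand vanishes outside a null set [N], and since [w] is positive this forces
    [p] to vanish there. If [p] were nonzero, [N] and its finite root set would cover an interval of
    positive measure. *)
Lemma weight_integral_sqr_eq0 (p : {poly R}) : L (p * p) = 0 -> p = 0.
Proof.
move=> Lp0; apply: contrapT => /eqP p0.
have mA := measurable_sym_itv; have ipp := integrable_poly_weight (p * p).
have pp_ge0 x : sym_itv a x -> (0 <= ((p * p).[x] * w x)%:E)%E.
  by move=> xA; rewrite lee_fin hornerM -expr2 mulr_ge0 ?sqr_ge0 // ltW // w_gt0.
have : (\int[mu]_(x in sym_itv a) `|((p * p).[x] * w x)%:E| = 0)%E.
  rewrite -[RHS](_ : (L (p * p))%:E = 0%E); last by rewrite Lp0.
  rewrite /L /Rintegral fineK; last exact: integrable_fin_num.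
  by apply: eq_integral => x /[!inE] xA; rewrite gee0_abs // pp_ge0.
move/(ae_eq_integral_abs mu mA (measurable_int mu ipp)) => -[N [mN N0 AN]].
have mroots : countable [set x | root p x] by exact/finite_set_countable/finite_set_root.
have mS : @measurable _ (measurableTypeR R) [set x | root p x].
  exact: countable_measurable.
have : (mu (sym_itv a) <= mu (N `|` [set x | root p x]))%E.
  apply: le_measure; rewrite ?inE //; first exact: measurableU.
  move=> x xA; have [px|px] := boolP (root p x); [by right|left].
  apply: AN => /(_ xA) /= [] /eqP; apply/negP.
  by rewrite hornerM !mulf_neq0 // gt_eqF // w_gt0.
rewrite leNgt => /negP; apply.
apply: le_lt_trans sym_itv_mu_gt0.
have NS0 : (mu N + mu [set x | root p x] <= 0)%E.
  by rewrite (N0 : mu N = 0%E) countable_lebesgue_measure0 // adde0.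
exact: le_trans (measureU2 mu mN mS) NS0.
Qed.

(** The point 0 is null and reflection carries the negative half onto [pos_itv a]. This links the
    one-sided integral in [wfunctional] to integrals over [sym_itv a]. *)
Lemma Rintegral_sym_itv (f : R -> R) :
  mu.-integrable (sym_itv a) (EFin \o f) ->
  \int[mu]_(x in sym_itv a) f x =
    \int[mu]_(x in pos_itv a) f x + \int[mu]_(x in pos_itv a) f (- x).
Proof.
have mP := measurable_pos_itv.
have mN : @measurable _ (measurableTypeR R) (-%R @^-1` pos_itv a).
  by rewrite -[X in measurable X]setTI; exact: oppr_measurable.
move=> intf; have := intf.
rewrite sym_itv_split => intf'.
have intPN := integrableS (measurableU _ _ (measurableU _ _ mP mN) (measurable_set1 0))
  (measurableU _ _ mP mN) (@subsetUl _ _ _) intf'.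
rewrite Rintegral_setU //; last 2 first.
- exact: measurableU.
- by apply/disj_setPS => x [/= [[]|[]] + _ x0]; rewrite x0 ?oppr0 ltxx.
rewrite Rintegral_set1 addr0 Rintegral_setU //; last first.
  apply/disj_setPS => x [[x0 _] [/= nx0 _]]; move: nx0.
  by rewrite oppr_gt0 ltNge (ltW x0).
congr (_ + _); rewrite (Rintegral_oppr mN).
  by congr Rintegral; apply/seteqP; split => x /=; rewrite opprK.
have intN : mu.-integrable (-%R @^-1` pos_itv a) (EFin \o f).
  apply: integrableS intf => //; first exact: measurable_sym_itv.
  by move=> x /sub_pos_sym_itv/sym_itv_oppr; rewrite opprK.
exact: intN.
Qed.

(** Reflection swaps the two half-interval integrals, [w] being even. *)
Lemma weight_integral_even (p : {poly R}) : L (p \Po - 'X) = L p.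
Proof.
rewrite /L (Rintegral_sym_itv (integrable_poly_weight (p \Po - 'X))).
rewrite (Rintegral_sym_itv (integrable_poly_weight p)) addrC.
by congr (_ + _); apply: eq_Rintegral => x /[!inE] /sub_pos_sym_itv xA;
  rewrite horner_comp hornerN hornerX ?opprK w_even.
Qed.

(** Symmetrising cancels the linear term of [p], and [- 2 * p.[0]] cancels the constant one. What is
    left is [(q.[x] + q.[- x]) * x ^+ 2]; after division by [x ^+ 2] it is the folded form of the
    integral of [q * w]. *)
Lemma wfunctionalE M (p : {poly R}) :
  wfunctional a w M p = L (drop_poly 2 p) + M * p`_0.
Proof.
rewrite /wfunctional horner_coef0; congr (_ + _).
set q := drop_poly 2 p.
rewrite /L (Rintegral_sym_itv (integrable_poly_weight q)).
have mP := measurable_pos_itv; have mA := measurable_sym_itv.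
have iq r := integrableS mA mP sub_pos_sym_itv (integrable_poly_weight r).
have -> : \int[mu]_(x in pos_itv a) (q.[- x] * w (- x)) =
    \int[mu]_(x in pos_itv a) ((q \Po - 'X).[x] * w x).
  apply: eq_Rintegral => x /[!inE] /sub_pos_sym_itv xA.
  by rewrite horner_comp hornerN hornerX w_even.
rewrite -RintegralD //; apply: eq_Rintegral => x /[!inE] -[x0 _].
rewrite horner_comp hornerN hornerX.
have pE y : p.[y] = p`_0 + p`_1 * y + q.[y] * y ^+ 2.
  rewrite -[in LHS](poly_take_drop 2 p) hornerD hornerM hornerXn -/q; congr (_ + _).
  by rewrite horner_poly !big_ord_recl big_ord0 /= addr0 expr0 mulr1 expr1.
have x0' : x != 0 by rewrite gt_eqF.
rewrite (pE x) (pE (- x)) sqrrN.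
have -> : p`_0 + p`_1 * x + q.[x] * x ^+ 2
    + (p`_0 + p`_1 * - x + q.[- x] * x ^+ 2) - 2 * p`_0
  = (q.[x] + q.[- x]) * x ^+ 2 by ring.
by field.
Qed.

End Lebesgue.

Theorem theorem3p3 (R : realType) (a : \bar R) (w : R -> R) (M : R)
    (P_ R_ : nat -> {poly R}) (beta : nat -> R)
    (a_gt0 : (0 < a)%E)
    (w_even : even_on (sym_itv a) w)
    (w_gt0 : forall x, sym_itv a x -> 0 < w x)
    (w_mom : finite_moments (sym_itv a) w)
    (P_orth : monic_orthogonal_polys (sym_itv a) w P_)
    (M_neq0 : M != 0)
    (wP_neq0 : forall n, wfunctional a w M (P_ (2 * n)%N) != 0)
    (R_monic : forall n, R_ n \is monic)
    (R_0 : R_ 0%N = 1)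
    (R_E : forall n, (1 <= n)%N -> R_ n = P_ n.+1 + beta n *: P_ n.-1)
    (R_deriv0 : forall n, (1 <= n)%N -> (R_ n)^`().[0] = 0)
    (wR_0 : forall n, (1 <= n)%N -> wfunctional a w M (R_ n) = 0) :
  exists K : nat -> R,
    (forall n, K n != 0) /\
    (forall n m, wfunctional a w M (R_ n * R_ m) = K n * (n == m)%:R).
Proof.
have [P_monic P_size P_ortho] := P_orth.
have Lsq := weight_integral_sqr_eq0 a_gt0 w_gt0 w_mom.
apply: (@R_orthogonal R (weight_integral a w) P_ _ Lsq _ P_monic P_size _
  (wfunctional a w M) R_ beta _ _ _ _ R_monic R_0 R_E _ wR_0).
- exact: weight_integralP.
- exact: weight_integral_even.
- move=> n m /P_ortho <-.
  by apply: eq_Rintegral => x _; rewrite hornerM.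
- move=> c p q; rewrite !(wfunctionalE a_gt0 w_even w_mom) linearP /=.
  by rewrite weight_integralP // coefD coefZ; ring.
(* Multiplication by ['X^2] kills the constant coefficient and is undone by [drop_poly 2]. *)
- move=> p; rewrite (wfunctionalE a_gt0 w_even w_mom) coefMXn mulr0 addr0.
  by rewrite drop_polyMXn_id.
(* The value at the constant 1 is [M], which is nonzero by hypothesis. *)
- rewrite (wfunctionalE a_gt0 w_even w_mom) coef1 mulr1 drop_poly_eq0 ?size_poly1 //.
  rewrite /weight_integral; under eq_Rintegral do rewrite horner0 mul0r.
  by rewrite Rintegral_cst ?mul0r ?add0r //; exact: measurable_sym_itv.
- by move=> n; rewrite -mul2n.
- by move=> n /R_deriv0; rewrite horner_coef0 coef_deriv mulr1n.
Qed.
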